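(* Let $\mathfrak g=\mathrm T^*\mathfrak h_3$ with basis $e_1,\dots,e_6$, non-zero commutators $[e_1,e_2]=e_6$, $[e_1,e_3]=-e_5$, $[e_2,e_3]=e_4$, and center $\mathfrak g'=\mathbb R\langle e_4,e_5,e_6\rangle$. Let $\tau$ denote scalar curvature. (i) The scalar curvature of the metrics $(S,0,E_{pq})$, $p+q=3$ (non-degenerate center $\mathfrak g'$) is $\tau=-\dfrac{\mathrm{trace}(S E_{pq})}{2\det S}$. (ii) The metrics $(S,M,\pm E_{pq})$, $p+q=2$, with $(S,M)$ of form (a), respectively (c), have non-zero scalar curvature $\tau=\mp\dfrac{\epsilon}{2s_{22}s_{33}}$, respectively $\tau=\pm\dfrac{\epsilon}{2s_{12}^2}$, where $\epsilon$ is the entry of $E_{pq}$ in position $(3,3)$. (iii) All other metrics in the canonical list with degenerate center $\mathfrak g'$ have scalar curvature $\tau=0$.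
   Context: A left invariant metric is identified with a non-degenerate symmetric bilinear form on $\mathfrak g$. The triple $(S,M,E)$ denotes the metric with Gram matrix $\begin{pmatrix}S&M\\ M^T&E\end{pmatrix}$ in the basis $e$; parameters are real and such that it is non-degenerate. Scalar curvature is the trace of the Ricci operator. Notation: $E_{30}=I=-E_{03}$, $E_{21}=\mathrm{diag}(1,1,-1)=-E_{12}$, $E_{20}=\mathrm{diag}(0,1,1)$, $E_{11}=\mathrm{diag}(0,1,-1)$, $E_{10}=\mathrm{diag}(0,0,1)$; in (ii) $E_{pq}$ is $E_{20}$ or $E_{11}$. Canonical list with degenerate center. Rank 2 forms of $(S,M)$: (a) $S=\mathrm{diag}(0,s_{22},s_{33})$, $s_{22},s_{33}\ne0$, $M=\begin{pmatrix}1&0&0\\0&0&0\\1&0&0\end{pmatrix}$; (b) $S=\mathrm{diag}(0,s_{22},s_{33})$, $s_{22},s_{33}\ne0$, $M=\mathrm{diag}(1,0,0)$; (c) $S=\begin{pmatrix}0&s_{12}&0\\ s_{12}&0&0\\0&0&0\end{pmatrix}$, $s_{12}\ne0$, $M=\begin{pmatrix}0&0&0\\0&0&0\\1&0&0\end{pmatrix}$; (d) $S=\mathrm{diag}(s_{11},s_{22},0)$, $s_{11},s_{22}\ne0$, $M=\begin{pmatrix}0&0&0\\1&0&0\\1&0&0\end{pmatrix}$; (e) $S=\begin{pmatrix}0&s_{12}&0\\ s_{12}&0&0\\0&0&0\end{pmatrix}$, $s_{12}>0$, $M=\begin{pmatrix}0&0&0\\1&0&0\\1&0&0\end{pmatrix}$;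 (f) $S=\begin{pmatrix}0&0&0\\0&s_{22}&\frac12|s_{22}|\\0&\frac12|s_{22}|&0\end{pmatrix}$, $s_{22}\ne0$, $M=\mathrm{diag}(1,0,0)$; (g) $S=\begin{pmatrix}0&0&0\\0&0&\frac12|s_{33}|\\0&\frac12|s_{33}|&s_{33}\end{pmatrix}$, $s_{33}\ne0$, $M=\mathrm{diag}(1,0,0)$. Rank 2 metrics: $(S,M,\pm E_{20})$ with (a), (b), (c); $(S,M,\pm E_{11})$ with (a), (c); $(S,M,E_{11})$ with (b), (d), (e), (f), (g). Rank 1 metrics: $(\pm E_{10},M,\pm E_{10})$ (independent signs) with $M$ one of $\begin{pmatrix}0&m_{12}&0\\1&0&0\\1&0&0\end{pmatrix}$, $\begin{pmatrix}m_{11}&0&0\\0&m_{22}&0\\0&0&0\end{pmatrix}$, $\begin{pmatrix}m_{11}&m_{12}&0\\-m_{12}&m_{11}&0\\0&0&0\end{pmatrix}$, $\begin{pmatrix}m_{11}&0&0\\1&m_{11}&0\\0&0&0\end{pmatrix}$. Rank 0 metrics: $(0,M,0)$ with $M$ regular, one of $\begin{pmatrix}1&0&0\\0&\lambda_2&0\\0&0&\lambda_3\end{pmatrix}$, $\begin{pmatrix}1&0&0\\0&\lambda_2&1\\0&0&\lambda_2\end{pmatrix}$, $\begin{pmatrix}1&1&0\\0&1&1\\0&0&1\end{pmatrix}$, $\begin{pmatrix}1&0&0\\0&\lambda_2&-\lambda_3\\0&\lambda_3&\lambda_2\end{pmatrix}$. *)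

(* Defs.v *)
From HB Require Import structures.
From mathcomp Require Import all_boot all_order all_algebra reals.
From mathcomp Require Import ring.

Set Implicit Arguments.
Unset Strict Implicit.
Unset Printing Implicit Defensive.

Import Order.TTheory GRing.Theory Num.Theory.
Local Open Scope ring_scope.

(* Left invariant pseudo-Riemannian geometry, computed in the Lie algebra
   R^n (row vectors) with bracket br; G is the Gram matrix of the metric in the
   standard basis. *)

Definition form (R : realType) (n : nat) (G : 'M[R]_n) (x y : 'rV[R]_n) : R :=
  (x *m G *m y^T) 0 0.

(* The vector representing a linear functional phi with respect to the metric:
   form G (riesz G phi) z = phi z (see rieszP). *)
Definition riesz (R : realType) (n : nat) (G : 'M[R]_n) (phi : 'rV[R]_n -> R) :
    'rV[R]_n :=
  (\row_k phi (delta_mx 0 k)) *m invmx G.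

(* Koszul formula for left invariant fields:
   2 <nabla_x y, z> = <[x,y],z> - <[y,z],x> + <[z,x],y>. *)
Definition levi_civita (R : realType) (n : nat)
    (br : 'rV[R]_n -> 'rV[R]_n -> 'rV[R]_n) (G : 'M[R]_n) (x y : 'rV[R]_n) :
    'rV[R]_n :=
  riesz G (fun z =>
    (form G (br x y) z - form G (br y z) x + form G (br z x) y) / 2).

Definition curvature (R : realType) (n : nat)
    (br : 'rV[R]_n -> 'rV[R]_n -> 'rV[R]_n) (G : 'M[R]_n)
    (x y z : 'rV[R]_n) : 'rV[R]_n :=
  let nabla := levi_civita br G in
  nabla x (nabla y z) - nabla y (nabla x z) - nabla (br x y) z.

Definition ricci (R : realType) (n : nat)
    (br : 'rV[R]_n -> 'rV[R]_n -> 'rV[R]_n) (G : 'M[R]_n) (y z : 'rV[R]_n) : R :=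
  \tr (lin1_mx (fun x => curvature br G x y z)).

Definition ricci_operator (R : realType) (n : nat)
    (br : 'rV[R]_n -> 'rV[R]_n -> 'rV[R]_n) (G : 'M[R]_n) (y : 'rV[R]_n) :
    'rV[R]_n :=
  riesz G (ricci br G y).

Definition scalar_curvature (R : realType) (n : nat)
    (br : 'rV[R]_n -> 'rV[R]_n -> 'rV[R]_n) (G : 'M[R]_n) : R :=
  \tr (lin1_mx (ricci_operator br G)).

(* 1-based: e 1, ..., e 6, and coord x k is the coefficient of e k in x. *)
Definition e (R : realType) (k : nat) : 'rV[R]_6 := delta_mx 0 (inord k.-1).
Arguments e {R} k.

Definition coord (R : realType) (x : 'rV[R]_6) (k : nat) : R :=
  x 0 (inord k.-1).

(* The bracket of T^*h_3: the alternating bilinear map with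
   [e1,e2] = e6, [e1,e3] = -e5, [e2,e3] = e4 and central e4, e5, e6. *)
Definition bracket (R : realType) (x y : 'rV[R]_6) : 'rV[R]_6 :=
  (coord x 1 * coord y 2 - coord x 2 * coord y 1) *: e 6
  - (coord x 1 * coord y 3 - coord x 3 * coord y 1) *: e 5
  + (coord x 2 * coord y 3 - coord x 3 * coord y 2) *: e 4.

Definition metric (R : realType) (S M E : 'M[R]_3) : 'M[R]_(3 + 3) :=
  block_mx S M M^T E.

Definition tau (R : realType) (S M E : 'M[R]_3) : R :=
  scalar_curvature (@bracket R) (metric S M E).

Definition mx3 (R : realType) (a b c d f g h k l : R) : 'M[R]_3 :=
  \matrix_(i < 3, j < 3)
    nth 0 (nth [::] [:: [:: a; b; c]; [:: d; f; g]; [:: h; k; l]] i) j.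

Definition diag3 (R : realType) (a b c : R) : 'M[R]_3 :=
  mx3 a 0 0
      0 b 0
      0 0 c.

Definition E30 (R : realType) : 'M[R]_3 := 1%:M.
Definition E03 (R : realType) : 'M[R]_3 := - E30 R.
Definition E21 (R : realType) : 'M[R]_3 := diag3 1 1 (-1).
Definition E12 (R : realType) : 'M[R]_3 := - E21 R.
Definition E20 (R : realType) : 'M[R]_3 := diag3 0 1 1.
Definition E11 (R : realType) : 'M[R]_3 := diag3 0 1 (-1).
Definition E10 (R : realType) : 'M[R]_3 := diag3 0 0 1.

(* s = false is the sign +, s = true the sign -. *)
Definition pm (R : realType) (s : bool) (A : 'M[R]_3) : 'M[R]_3 :=
  (-1) ^+ s *: A.

Definition S12 (R : realType) (s12 : R) : 'M[R]_3 :=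
  mx3 0   s12 0
      s12 0   0
      0   0   0.

Definition M1 (R : realType) : 'M[R]_3 := diag3 1 0 0.
Definition M13 (R : realType) : 'M[R]_3 :=
  mx3 1 0 0
      0 0 0
      1 0 0.
Definition M3 (R : realType) : 'M[R]_3 :=
  mx3 0 0 0
      0 0 0
      1 0 0.
Definition M23 (R : realType) : 'M[R]_3 :=
  mx3 0 0 0
      1 0 0
      1 0 0.

Variant form_a (R : realType) : 'M[R]_3 -> 'M[R]_3 -> Prop :=
  FormA (s22 s33 : R) of s22 != 0 & s33 != 0 :
    form_a (diag3 0 s22 s33) (M13 R).

Variant form_b (R : realType) : 'M[R]_3 -> 'M[R]_3 -> Prop :=
  FormB (s22 s33 : R) of s22 != 0 & s33 != 0 :
    form_b (diag3 0 s22 s33) (M1 R).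

Variant form_c (R : realType) : 'M[R]_3 -> 'M[R]_3 -> Prop :=
  FormC (s12 : R) of s12 != 0 : form_c (S12 s12) (M3 R).

Variant form_d (R : realType) : 'M[R]_3 -> 'M[R]_3 -> Prop :=
  FormD (s11 s22 : R) of s11 != 0 & s22 != 0 :
    form_d (diag3 s11 s22 0) (M23 R).

Variant form_e (R : realType) : 'M[R]_3 -> 'M[R]_3 -> Prop :=
  FormE (s12 : R) of 0 < s12 : form_e (S12 s12) (M23 R).

Variant form_f (R : realType) : 'M[R]_3 -> 'M[R]_3 -> Prop :=
  FormF (s22 : R) of s22 != 0 :
    form_f (mx3 0 0            0
                0 s22          (`|s22| / 2)
                0 (`|s22| / 2) 0) (M1 R).

Variant form_g (R : realType) : 'M[R]_3 -> 'M[R]_3 -> Prop :=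
  FormG (s33 : R) of s33 != 0 :
    form_g (mx3 0 0            0
                0 0            (`|s33| / 2)
                0 (`|s33| / 2) s33) (M1 R).

Variant rank2_list (R : realType) : 'M[R]_3 -> 'M[R]_3 -> 'M[R]_3 -> Prop :=
  | Rank2_20 S M s of form_a S M \/ form_b S M \/ form_c S M :
      rank2_list S M (pm s (E20 R))
  | Rank2_pm11 S M s of form_a S M \/ form_c S M :
      rank2_list S M (pm s (E11 R))
  | Rank2_11 S M of form_b S M \/ form_d S M \/ form_e S M \/ form_f S M
                    \/ form_g S M :
      rank2_list S M (E11 R).

Variant rank1_M (R : realType) : 'M[R]_3 -> Prop :=
  | Rank1_1 m12 :
      rank1_M (mx3 0 m12 0
                   1 0   0
                   1 0   0)
  | Rank1_2 m11 m22 : rank1_M (diag3 m11 m22 0)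
  | Rank1_3 m11 m12 :
      rank1_M (mx3 m11     m12 0
                   (- m12) m11 0
                   0       0   0)
  | Rank1_4 m11 :
      rank1_M (mx3 m11 0   0
                   1   m11 0
                   0   0   0).

Variant rank1_list (R : realType) : 'M[R]_3 -> 'M[R]_3 -> 'M[R]_3 -> Prop :=
  Rank1 M s t of rank1_M M : rank1_list (pm s (E10 R)) M (pm t (E10 R)).

Variant rank0_M (R : realType) : 'M[R]_3 -> Prop :=
  | Rank0_1 l2 l3 : rank0_M (diag3 1 l2 l3)
  | Rank0_2 l2 :
      rank0_M (mx3 1 0  0
                   0 l2 1
                   0 0  l2)
  | Rank0_3 :
      rank0_M (mx3 1 1 0
                   0 1 1
                   0 0 1)
  | Rank0_4 l2 l3 :
      rank0_M (mx3 1 0  0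
                   0 l2 (- l3)
                   0 l3 l2).

Variant rank0_list (R : realType) : 'M[R]_3 -> 'M[R]_3 -> 'M[R]_3 -> Prop :=
  Rank0 M of rank0_M M & M \in unitmx : rank0_list 0 M 0.

Definition degenerate_center_list (R : realType) (S M E : 'M[R]_3) : Prop :=
  metric S M E \in unitmx
  /\ (rank2_list S M E \/ rank1_list S M E \/ rank0_list S M E).

Variant rank2_ac (R : realType) : 'M[R]_3 -> 'M[R]_3 -> 'M[R]_3 -> Prop :=
  Rank2AC S M Epq s of (Epq = E20 R \/ Epq = E11 R)
                     & (form_a S M \/ form_c S M) :
    rank2_ac S M (pm s Epq).

Lemma formDl (R : realType) n (G : 'M[R]_n) x y z :
  form G (x + y) z = form G x z + form G y z.
Proof. by rewrite /form !mulmxDl mxE. Qed.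

Lemma formDr (R : realType) n (G : 'M[R]_n) x y z :
  form G x (y + z) = form G x y + form G x z.
Proof. by rewrite /form linearD mulmxDr mxE. Qed.

Lemma formZl (R : realType) n (G : 'M[R]_n) a x z :
  form G (a *: x) z = a * form G x z.
Proof. by rewrite /form -!scalemxAl mxE. Qed.

Lemma formZr (R : realType) n (G : 'M[R]_n) a x z :
  form G x (a *: z) = a * form G x z.
Proof. by rewrite /form linearZ -scalemxAr mxE. Qed.

Lemma formC (R : realType) n (G : 'M[R]_n) x y :
  G^T = G -> form G x y = form G y x.
Proof.
move=> sG; rewrite /form.
have -> : y *m G *m x^T = (x *m G *m y^T)^T by rewrite !trmx_mul trmxK sG mulmxA.
by rewrite [RHS]mxE.
Qed.

Lemma form_inj (R : realType) n (G : 'M[R]_n) x y :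
  G \in unitmx -> (forall z, form G x z = form G y z) -> x = y.
Proof.
move=> uG h; rewrite -[x](mulmxK uG) -[y](mulmxK uG); congr (_ *m _).
apply/rowP => k; have := h (delta_mx 0 k).
by rewrite /form trmx_delta -!colE !mxE.
Qed.

Lemma rieszP (R : realType) n (G : 'M[R]_n) (phi : 'rV[R]_n -> R) z :
  G \in unitmx -> scalar phi -> form G (riesz G phi) z = phi z.
Proof.
move=> uG lphi; rewrite /form /riesz mulmxKV // mxE.
pose p : {scalar 'rV[R]_n} :=
  HB.pack phi (GRing.isLinear.Build R 'rV[R]_n R *%R phi lphi).
rewrite -[phi]/(p : _ -> _) [z in RHS]row_sum_delta linear_sum.
by apply: eq_bigr => k _; rewrite scalarZ !mxE mulrC.
Qed.

Lemma levi_civitaP (R : realType) n br (G : 'M[R]_n) x y z :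
  (forall x, linear (br x)) -> (forall x y, br x y = - br y x) ->
  G \in unitmx ->
  form G (levi_civita br G x y) z
  = (form G (br x y) z - form G (br y z) x + form G (br z x) y) / 2.
Proof.
move=> lbr abr uG; rewrite /levi_civita rieszP // => a u v.
rewrite lbr ![br _ x]abr lbr -!scaleN1r !(formDl, formDr, formZl, formZr).
by rewrite /=; field.
Qed.

Lemma levi_civita_torsion_free (R : realType) n br (G : 'M[R]_n) x y :
  (forall x, linear (br x)) -> (forall x y, br x y = - br y x) ->
  G \in unitmx ->
  levi_civita br G x y - levi_civita br G y x = br x y.
Proof.
move=> lbr abr uG; apply: (form_inj uG) => z.
rewrite -scaleN1r formDl formZl !levi_civitaP //.
rewrite [br y x]abr [br z y]abr [br z x]abr -!scaleN1r !formZl.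
by field.
Qed.

Lemma levi_civita_metric (R : realType) n br (G : 'M[R]_n) x y z :
  (forall x, linear (br x)) -> (forall x y, br x y = - br y x) ->
  G^T = G -> G \in unitmx ->
  form G (levi_civita br G x y) z + form G y (levi_civita br G x z) = 0.
Proof.
move=> lbr abr sG uG; rewrite [form G y _]formC // !levi_civitaP //.
rewrite [br z y]abr [br z x]abr [br y x]abr -!scaleN1r !formZl.
by field.
Qed.

Lemma levi_civita_unique (R : realType) n br (G : 'M[R]_n)
    (nabla : 'rV[R]_n -> 'rV[R]_n -> 'rV[R]_n) x y :
  (forall x, linear (br x)) -> (forall x y, br x y = - br y x) ->
  G^T = G -> G \in unitmx ->
  (forall x y, nabla x y - nabla y x = br x y) ->
  (forall x y z, form G (nabla x y) z + form G y (nabla x z) = 0) ->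
  nabla x y = levi_civita br G x y.
Proof.
move=> lbr abr sG uG tf mc; apply: (form_inj uG) => z.
rewrite levi_civitaP // -!tf -!scaleN1r !(formDl, formZl).
have h1 := mc x y z; have h2 := mc y z x; have h3 := mc z x y.
rewrite ![form G _ (nabla _ _)]formC // in h1 h2 h3.
move/eqP: h1; rewrite addr_eq0 => /eqP h1.
move/eqP: h2; rewrite addr_eq0 => /eqP h2.
move/eqP: h3; rewrite addr_eq0 => /eqP h3.
by rewrite h1 h2 h3; field.
Qed.

Lemma coord_e (R : realType) j k : (0 < j <= 6)%N -> (0 < k <= 6)%N ->
  coord (e j : 'rV[R]_6) k = (k == j)%:R.
Proof.
case: j k => [//|j] [|k] //= hj hk.
by rewrite /coord /e mxE /= -val_eqE /= !inordK.
Qed.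

Lemma bracket_e (R : realType) j k : (0 < j < k)%N -> (k <= 6)%N ->
  bracket (e j) (e k) =
  match j, k with
  | 1%N, 2%N => e 6
  | 1%N, 3%N => - e 5
  | 2%N, 3%N => e 4
  | _, _ => 0
  end :> 'rV[R]_6.
Proof.
move=> /andP[j0 jk] k6.
have jb : (0 < j <= 6)%N by rewrite j0 (leq_trans (ltnW jk)).
have kb : (0 < k <= 6)%N by rewrite (leq_trans j0 (ltnW jk)).
rewrite /bracket !coord_e //.
case: j k j0 jk k6 {jb kb} => [|[|[|[|[|[|j]]]]]] [|[|[|[|[|[|[|k]]]]]]] // _ _ _;
  by rewrite /= ?(mulr0, mul0r, mulr1, subr0, sub0r, scale0r, scale1r, addr0,
                  add0r, oppr0).
Qed.

Lemma bracket_linear (R : realType) (x : 'rV[R]_6) : linear (bracket x).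
Proof.
by move=> a y z; apply/rowP => k; rewrite /bracket /coord !mxE; ring.
Qed.

Lemma bracketC (R : realType) (x y : 'rV[R]_6) : bracket x y = - bracket y x.
Proof. by apply/rowP => k; rewrite /bracket /coord !mxE; ring. Qed.

Lemma bracket_nilpotent (R : realType) (x y z : 'rV[R]_6) :
  bracket x (bracket y z) = 0.
Proof.
have cE (u v w : 'rV[R]_6) a b d k :
    coord (a *: u - b *: v + d *: w) k
    = a * coord u k - b * coord v k + d * coord w k.
  by rewrite /coord !mxE.
have c k : (0 < k <= 3)%N -> coord (bracket y z) k = 0.
  move=> /andP[k0 k3]; have kb : (0 < k <= 6)%N by rewrite k0 (leq_trans k3).
  rewrite /bracket cE !coord_e //.
  by case: k k0 k3 {kb} => [|[|[|[|k]]]] //= _ _; rewrite !mulr0 subr0 addr0.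
by rewrite {1}/bracket !c // !(mulr0, subr0, scale0r, addr0).
Qed.

Lemma bracket_jacobi (R : realType) (x y z : 'rV[R]_6) :
  bracket x (bracket y z) + bracket y (bracket z x) + bracket z (bracket x y)
  = 0.
Proof. by rewrite !bracket_nilpotent !addr0. Qed.

Lemma bracket_center (R : realType) (x : 'rV[R]_6) :
  (forall y, bracket x y = 0) <-> (forall k, (0 < k <= 3)%N -> coord x k = 0).
Proof.
split=> [h k|h y]; last first.
  by rewrite /bracket !h // !mul0r !subrr !scale0r subrr addr0.
have cE (u v w : 'rV[R]_6) a b d j :
    coord (a *: u - b *: v + d *: w) j
    = a * coord u j - b * coord v j + d * coord w j.
  by rewrite /coord !mxE.
have c0 j : coord (0 : 'rV[R]_6) j = 0 by rewrite /coord mxE.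
have h1 := congr1 (@coord R ^~ 6) (h (e 2)).
have h2 := congr1 (@coord R ^~ 6) (h (e 1)).
have h3 := congr1 (@coord R ^~ 5) (h (e 1)).
move: h1 h2 h3; rewrite /= /bracket !cE !c0 !coord_e //=.
rewrite !(mulr0, mulr1, subr0, sub0r, addr0, oppr0, opprK) => h1.
move=> /eqP; rewrite oppr_eq0 => /eqP h2 h3.
by case: k => [|[|[|[|k]]]].
Qed.

(* Main.v *)
(** For a left invariant metric on a 2-step nilpotent Lie group, contracting the
    Koszul formula with a basis [e_i] and its metric dual basis [e^i] gives
    [tau = - 1/4 \sum_ij <[e_i, e_j], [e^i, e^j]>]: every contraction producing
    a double bracket vanishes.  The bracket of [T^*h_3] is the cross product
    [R^3 x R^3 -> g'], so this becomes [tau = - 1/2 tr (adj A * E)], where [A] is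
    the upper left block of the inverse Gram matrix.  If the center is
    nondegenerate and [M = 0], then [A] is the inverse of [S].  If [E] has null
    rows, then the corresponding columns of [M] lie in the kernel of [A].  For
    [E] of rank at most 1 this forces [adj A = 0]; for [E] of rank 2 it
    determines [adj A] up to a factor, and [tr (adj A * E)] vanishes except for
    the forms (a) and (c), where the Gram matrix is inverted explicitly. *)

From HB Require Import structures.
From mathcomp Require Import all_boot all_order all_algebra reals.
From mathcomp Require Import ring.
(* After [all_algebra], whose sesquilinear forms define the same names. *)
Require Import Defs.

Set Implicit Arguments.
Unset Strict Implicit.
Unset Printing Implicit Defensive.

Import Order.TTheory GRing.Theory Num.Theory.
Local Open Scope ring_scope.

(** Full-rank factorization: if [A = C *m B] with [C] of full column rank and [B] of full row rank,
    then [A *m A = 0] cancels to [B *m C = 0], whose trace is that of [A]. *)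
Lemma mxtrace_sqr0 (F : fieldType) n (A : 'M[F]_n) : A *m A = 0 -> \tr A = 0.
Proof.
move=> AA; rewrite -[A in \tr A]mulmx_base mxtrace_mulC.
suff -> : row_base A *m col_base A = 0 by rewrite mxtrace0.
apply: (row_free_inj (row_base_free A)); rewrite mul0mx.
apply: (row_full_inj (col_base_full A)); rewrite mulmx0.
have := mulmx_base A; move: (row_base A) (col_base A) => B C CB.
by rewrite -mulmxA CB mulmxA CB.
Qed.

(** Serves maps such as [br x] or [curvature br G x y], whose linearity is a proposition and not a
    canonical structure. *)
Lemma linear_sumE (R : pzRingType) (U V : lmodType R) (f : U -> V) (I : finType)
    (a : I -> R) (v : I -> U) :
  linear f -> f (\sum_i a i *: v i) = \sum_i a i *: f (v i).
Proof.
move=> lf; pose p : {linear U -> V} := HB.pack f (GRing.isLinear.Build R U V *:%R f lf).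
rewrite -[f]/(p : _ -> _) linear_sum.
by apply: eq_bigr => i _; rewrite linearZ.
Qed.

(** * Metric dual basis and contractions *)

Definition dual_basis (R : realType) n (G : 'M[R]_n) (i : 'I_n) : 'rV[R]_n :=
  row i (invmx G).

Section DualBasis.
Variables (R : realType) (n : nat) (G : 'M[R]_n).
Hypotheses (sG : G^T = G) (uG : G \in unitmx).

Local Notation d := (delta_mx 0).
Local Notation d' := (dual_basis G).

Lemma invmx_symE i j : invmx G i j = invmx G j i.
Proof. by rewrite -[in LHS]sG -trmx_inv mxE. Qed.

Lemma dual_basis_sum i : d' i = \sum_k invmx G i k *: d k.
Proof. by rewrite [LHS]row_sum_delta; apply: eq_bigr => k _; rewrite mxE. Qed.

Lemma form_dual_basis u i : form G u (d' i) = u 0 i.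
Proof.
rewrite formC // /form /dual_basis -row_mul mulVmx //.
by rewrite row1 -rowE !mxE.
Qed.

Lemma form_delta u i : form G u (d i) = (u *m G) 0 i.
Proof. by rewrite /form trmx_delta -colE mxE. Qed.

Lemma form_contract u v : \sum_i form G u (d i) * form G v (d' i) = form G u v.
Proof.
rewrite /form [RHS]mxE; apply: eq_bigr => i _.
by rewrite -/(form G u (d i)) -/(form G v (d' i)) form_delta form_dual_basis [v^T _ _]mxE.
Qed.

(** Both sides expand to the contraction of [B] with the symmetric matrix [invmx G]. The codomain
    [R^o] lets [linear_sumE] apply. *)
Lemma trace_swap (B : 'rV[R]_n -> 'rV[R]_n -> R^o) :
  (forall x, linear (B x)) -> (forall y, linear (B^~ y)) ->
  \sum_i B (d i) (d' i) = \sum_i B (d' i) (d i).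
Proof.
move=> lr ll; under eq_bigr do rewrite dual_basis_sum linear_sumE //.
under [RHS]eq_bigr => i _ do
  rewrite dual_basis_sum (linear_sumE (f := B^~ (d i))) //.
rewrite exchange_big; apply: eq_bigr => i _; apply: eq_bigr => k _.
by rewrite invmx_symE.
Qed.

End DualBasis.

(** * Scalar curvature of a 2-step nilpotent metric Lie algebra *)

Section TwoStepNilpotent.
Variables (R : realType) (n : nat) (br : 'rV[R]_n -> 'rV[R]_n -> 'rV[R]_n).
Variable (G : 'M[R]_n).
Hypotheses (lbr : forall x, linear (br x)) (abr : forall x y, br x y = - br y x).
Hypothesis nbr : forall x y z, br x (br y z) = 0.
Hypotheses (sG : G^T = G) (uG : G \in unitmx).

Local Notation d := (delta_mx 0).
Local Notation d' := (dual_basis G).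
Local Notation D := (levi_civita br G).
Local Notation g := (form G).

Lemma formNl u v : g (- u) v = - g u v.
Proof. by rewrite -scaleN1r formZl mulN1r. Qed.

Lemma formNr u v : g u (- v) = - g u v.
Proof. by rewrite -scaleN1r formZr mulN1r. Qed.

Lemma form0l v : g 0 v = 0.
Proof. by rewrite -[0](scale0r 0) formZl mul0r. Qed.

Lemma form_suml (I : finType) (F : I -> 'rV[R]_n) v :
  g (\sum_i F i) v = \sum_i g (F i) v.
Proof. by apply: (big_morph (g^~ v)) => [x y|]; rewrite ?formDl ?form0l. Qed.

Lemma form_sumr (I : finType) (F : I -> 'rV[R]_n) v :
  g v (\sum_i F i) = \sum_i g v (F i).
Proof. by rewrite formC // form_suml; apply: eq_bigr => i _; rewrite formC. Qed.

Lemma linear_br_l y : linear (br^~ y).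
Proof. by move=> a u v; rewrite abr lbr ![br y _]abr -scaleN1r !scalerDr !scalerN !scaleN1r !opprK. Qed.

Lemma nbr_l x y z : br (br x y) z = 0.
Proof. by rewrite abr nbr oppr0. Qed.

(** The sum is the trace of ad z, which squares to zero because double brackets vanish. *)
Lemma trace_ad0 z : \sum_i g (br z (d i)) (d' i) = 0.
Proof.
under eq_bigr do rewrite form_dual_basis //.
pose A := lin1_mx (br z).
have AE x : x *m A = br z x.
  rewrite [x in LHS]row_sum_delta [x in RHS]row_sum_delta linear_sumE //.
  rewrite mulmx_suml; apply: eq_bigr => k _; rewrite -scalemxAl; congr (_ *: _).
  by apply/rowP => j; rewrite -rowE !mxE.
have AA : A *m A = 0.
  by apply/row_matrixP => i; rewrite row_mul row0 rowE !AE nbr.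
by rewrite -[RHS](mxtrace_sqr0 AA) /mxtrace; apply: eq_bigr => i _; rewrite mxE.
Qed.

Lemma linear_levi_civita x : linear (D x).
Proof.
move=> a u v; apply: (form_inj uG) => z.
rewrite formDl formZl !levi_civitaP // lbr linear_br_l.
by rewrite !(formDl, formZl, formDr, formZr); field.
Qed.

Lemma linear_curvature x y : linear (curvature br G x y).
Proof.
move=> a u v; rewrite /curvature !linear_levi_civita.
by apply/rowP => k; rewrite !mxE; ring.
Qed.

(** Metric compatibility moves the outer derivative to the other argument. In the Koszul formula for
    the derivative along [br x y], two of the three terms contain a double bracket, and only the one
    pairing [br z w] with [br x y] remains. *)
Lemma form_curvature x y z w :
  g (curvature br G x y z) w =
    g (D x z) (D y w) - g (D y z) (D x w) + g (br z w) (br x y) / 2.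
Proof.
have h a b c : g (D a b) c = - g b (D a c).
  by apply/eqP; rewrite -addr_eq0 levi_civita_metric.
rewrite /curvature !(formDl, formNl) [g (D x (D y z)) _]h [g (D y (D x z)) _]h.
rewrite [g (D (br x y) z) w]levi_civitaP // nbr_l nbr !form0l.
by field.
Qed.

Lemma scalar_curvature_dual :
  scalar_curvature br G =
  \sum_i \sum_j g (curvature br G (d j) (d i) (d' i)) (d' j).
Proof.
apply: eq_bigr => i _; rewrite mxE /ricci_operator /riesz mxE.
under [RHS]eq_bigr => j _ do
  rewrite dual_basis_sum (linear_sumE _ _ (linear_curvature _ _)) form_suml.
rewrite exchange_big; apply: eq_bigr => k _; rewrite mxE /ricci /mxtrace.
rewrite mulr_suml; apply: eq_bigr => j _.
by rewrite formZl form_dual_basis // !mxE mulrC invmx_symE.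
Qed.

(** Paired with [z], the Koszul formula gives a skew bracket contracted symmetrically, which
    vanishes, and two copies of the trace of ad z. *)
Lemma trace_levi_civita0 : \sum_i D (d i) (d' i) = 0.
Proof.
apply: (form_inj uG) => z; rewrite form_suml form0l.
under eq_bigr do rewrite levi_civitaP //.
rewrite -mulr_suml !big_split /=.
have -> : \sum_i g (br (d i) (d' i)) z = 0.
  (* Adding to the sum its copy with the two bases exchanged gives zero term by term. *)
  apply/eqP; rewrite -[_ == 0](mulrn_eq0 _ 2) mulr2n.
  rewrite [X in X + _](trace_swap sG (B := fun x y => g (br x y) z)).
  - rewrite -big_split big1 // => i _ /=.
    by rewrite abr formNl addNr.
  - by move=> x a u v; rewrite lbr formDl formZl.
  - by move=> x a u v; rewrite linear_br_l formDl formZl.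
under [X in _ + X + _]eq_bigr do rewrite abr formNl opprK.
rewrite -(trace_swap sG (B := fun x y => g (br z x) y)).
- by rewrite trace_ad0 !addr0 mul0r.
- by move=> x a u v; rewrite formDr formZr.
- by move=> x a u v; rewrite lbr formDl formZl.
Qed.

(** The squared length of the bracket as a tensor, for the possibly indefinite metric. *)
Definition bracket_norm : R :=
  \sum_i \sum_j g (br (d i) (d j)) (br (d' i) (d' j)).

Lemma bracket_norm_swapr :
  \sum_i \sum_j g (br (d i) (d' j)) (br (d' i) (d j)) = bracket_norm.
Proof.
apply: eq_bigr => i _.
rewrite -(trace_swap sG (B := fun x y => g (br (d i) x) (br (d' i) y))) //.
- by move=> x a u v; rewrite lbr formDr formZr.
- by move=> x a u v; rewrite lbr formDl formZl.
Qed.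

Lemma form_contract' u v : \sum_i g u (d' i) * g v (d i) = g u v.
Proof.
by rewrite formC // -form_contract //; apply: eq_bigr => i _; rewrite mulrC.
Qed.

(** The coefficients [g u (d i)] reassemble [u] from the dual basis inside the bracket. The three
    variants after it exchange the two bases or the two slots of the bracket. *)
Lemma br_contract u y z :
  \sum_i g u (d i) * g (br (d' i) y) z = g (br u y) z.
Proof.
have uE : u = \sum_i g u (d i) *: d' i.
  apply: (form_inj uG) => w; rewrite form_suml -form_contract //.
  by apply: eq_bigr => i _; rewrite formZl [form G w _]formC.
rewrite [u in RHS]uE (linear_sumE _ _ (linear_br_l y)) form_suml.
by apply: eq_bigr => i _; rewrite formZl.
Qed.

Lemma br_contract' u y z :
  \sum_i g u (d' i) * g (br (d i) y) z = g (br u y) z.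
Proof.
rewrite [u in RHS]row_sum_delta (linear_sumE _ _ (linear_br_l y)) form_suml.
by apply: eq_bigr => i _; rewrite formZl form_dual_basis.
Qed.

Lemma br_contractr u y z :
  \sum_i g u (d i) * g (br y (d' i)) z = g (br y u) z.
Proof.
rewrite abr formNl -br_contract -sumrN.
by apply: eq_bigr => i _; rewrite abr formNl mulrN.
Qed.

Lemma br_contractr' u y z :
  \sum_i g u (d' i) * g (br y (d i)) z = g (br y u) z.
Proof.
rewrite abr formNl -br_contract' -sumrN.
by apply: eq_bigr => i _; rewrite abr formNl mulrN.
Qed.

(* After the Koszul formula, six of the nine products contract to a double
   bracket, the other three to [bracket_norm] with signs -, +, +. *)
Lemma trace_levi_civita_sqr :
  \sum_i \sum_j g (D (d j) (d' i)) (D (d i) (d' j)) = bracket_norm / 4.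
Proof.
(* The Koszul terms of the first factor paired with [d k] are [p1], [p2], [p3], those of the second
   paired with [d' k] are [q1], [q2], [q3]; in both the signs are +, -, +. *)
pose p1 i j k := g (br (d j) (d' i)) (d k).
pose p2 i j k := g (br (d' i) (d k)) (d j).
pose p3 i j k := g (br (d k) (d j)) (d' i).
pose q1 i j k := g (br (d i) (d' j)) (d' k).
pose q2 i j k := g (br (d' j) (d' k)) (d i).
pose q3 i j k := g (br (d' k) (d i)) (d' j).
pose T (p q : 'I_n -> 'I_n -> 'I_n -> R) :=
  \sum_i \sum_j \sum_k p i j k * q i j k.
have -> : \sum_i \sum_j g (D (d j) (d' i)) (D (d i) (d' j)) =
    (T p1 q1 - T p1 q2 + T p1 q3 - T p2 q1 + T p2 q2 - T p2 q3
     + T p3 q1 - T p3 q2 + T p3 q3) / 4.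
  rewrite /T -!sumrN -!big_split mulr_suml; apply: eq_bigr => i _ /=.
  rewrite -!sumrN -!big_split mulr_suml; apply: eq_bigr => j _ /=.
  rewrite -!sumrN -!big_split mulr_suml -form_contract //.
  apply: eq_bigr => k _ /=; rewrite !levi_civitaP //.
  by rewrite /p1 /p2 /p3 /q1 /q2 /q3; field.
have -> : T p1 q1 = - bracket_norm.
  rewrite -bracket_norm_swapr /T exchange_big -sumrN; apply: eq_bigr => j _.
  rewrite -sumrN; apply: eq_bigr => i _.
  by rewrite form_contract // [br (d i) _]abr formNr.
have -> : T p1 q2 = 0.
  rewrite /T big1 // => i _; rewrite big1 // => j _.
  by rewrite br_contractr nbr form0l.
have -> : T p1 q3 = 0.
  rewrite /T big1 // => i _; rewrite big1 // => j _.
  by rewrite br_contract nbr_l form0l.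
have -> : T p2 q1 = 0.
  rewrite /T big1 // => i _; rewrite big1 // => j _.
  by under eq_bigr do rewrite mulrC; rewrite br_contractr' nbr form0l.
have -> : T p2 q2 = 0.
  rewrite /T big1 // => i _; rewrite exchange_big big1 // => k _ /=.
  by rewrite br_contract nbr_l form0l.
have -> : T p2 q3 = - bracket_norm.
  rewrite -bracket_norm_swapr /T -sumrN; apply: eq_bigr => i _.
  rewrite exchange_big -sumrN; apply: eq_bigr => k _ /=.
  by rewrite form_contract // [br (d' k) _]abr formNr formC.
have -> : T p3 q1 = 0.
  rewrite /T exchange_big big1 // => j _; rewrite exchange_big big1 // => k _ /=.
  by rewrite br_contract' nbr_l form0l.
have -> : T p3 q2 = - bracket_norm.
  rewrite /T exchange_big.
  under eq_bigr do (rewrite exchange_big /=; under eq_bigr do rewrite form_contract').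
  rewrite exchange_big -sumrN; apply: eq_bigr => k _ /=.
  by rewrite -sumrN; apply: eq_bigr => j _; rewrite [br (d' j) _]abr formNr.
have -> : T p3 q3 = 0.
  rewrite /T exchange_big big1 // => j _; rewrite exchange_big big1 // => k _ /=.
  by rewrite br_contractr' nbr form0l.
by field.
Qed.

(** The three terms of [form_curvature] contribute [bracket_norm / 4], zero by [trace_levi_civita0],
    and [- (bracket_norm / 2)]. *)
Theorem scalar_curvature_two_step :
  scalar_curvature br G = - (bracket_norm / 4).
Proof.
rewrite scalar_curvature_dual.
under eq_bigr do (under eq_bigr do rewrite form_curvature; rewrite !big_split /=).
rewrite !big_split /= trace_levi_civita_sqr.
have -> : \sum_i \sum_j - g (D (d i) (d' i)) (D (d j) (d' j)) = 0.
  rewrite big1 // => i _; rewrite sumrN -form_sumr trace_levi_civita0.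
  by rewrite formC // form0l oppr0.
have -> : \sum_i \sum_j g (br (d' i) (d' j)) (br (d j) (d i)) / 2
        = - (bracket_norm / 2).
  rewrite -mulNr /bracket_norm -sumrN mulr_suml; apply: eq_bigr => i _.
  rewrite -sumrN mulr_suml; apply: eq_bigr => j _; congr (_ / _).
  by rewrite formC // abr formNl.
by field.
Qed.

End TwoStepNilpotent.

(** * Explicit 3 x 3 matrices and the cross product *)

Local Notation i0 := (@Ordinal 3 0 isT).
Local Notation i1 := (@Ordinal 3 1 isT).
Local Notation i2 := (@Ordinal 3 2 isT).

Section Matrices3.
Variable R : realType.
Implicit Types A S M E : 'M[R]_3.

Lemma ord3P (P : 'I_3 -> Prop) : P i0 -> P i1 -> P i2 -> forall i, P i.
Proof.
move=> P0 P1 P2 [[|[|[|//]]] h]; first by rewrite (bool_irrelevance h isT).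
  by rewrite (bool_irrelevance h isT).
by rewrite (bool_irrelevance h isT).
Qed.

Lemma sum3E (V : nmodType) (F : 'I_3 -> V) : \sum_i F i = F i0 + F i1 + F i2.
Proof.
rewrite !big_ord_recr big_ord0 /= add0r.
by congr (F _ + F _ + F _); apply: val_inj.
Qed.

Lemma mx3_eta A :
  A = mx3 (A i0 i0) (A i0 i1) (A i0 i2) (A i1 i0) (A i1 i1) (A i1 i2)
          (A i2 i0) (A i2 i1) (A i2 i2).
Proof. by apply/matrixP; apply: ord3P; apply: ord3P; rewrite mxE. Qed.

Lemma mul_mx3 (a b c d f g h k l a' b' c' d' f' g' h' k' l' : R) :
  mx3 a b c d f g h k l *m mx3 a' b' c' d' f' g' h' k' l' =
  mx3 (a * a' + b * d' + c * h') (a * b' + b * f' + c * k')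
      (a * c' + b * g' + c * l') (d * a' + f * d' + g * h')
      (d * b' + f * f' + g * k') (d * c' + f * g' + g * l')
      (h * a' + k * d' + l * h') (h * b' + k * f' + l * k')
      (h * c' + k * g' + l * l').
Proof. by apply/matrixP; apply: ord3P; apply: ord3P; rewrite !mxE sum3E !mxE. Qed.

Lemma mxtrace3E A : \tr A = A i0 i0 + A i1 i1 + A i2 i2.
Proof. exact: sum3E. Qed.

Lemma trmx_mx3 (a b c d f g h k l : R) :
  (mx3 a b c d f g h k l)^T = mx3 a d h b f k c g l.
Proof. by apply/matrixP; apply: ord3P; apply: ord3P; rewrite !mxE. Qed.

Lemma add_mx3 (a b c d f g h k l a' b' c' d' f' g' h' k' l' : R) :
  mx3 a b c d f g h k l + mx3 a' b' c' d' f' g' h' k' l' =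
  mx3 (a + a') (b + b') (c + c') (d + d') (f + f') (g + g')
      (h + h') (k + k') (l + l').
Proof. by apply/matrixP; apply: ord3P; apply: ord3P; rewrite !mxE. Qed.

Lemma mx3_0 : 0 = mx3 0 0 0 0 0 0 0 0 0 :> 'M[R]_3.
Proof. by apply/matrixP; apply: ord3P; apply: ord3P; rewrite !mxE. Qed.

Lemma mx3_1 : 1%:M = mx3 1 0 0 0 1 0 0 0 1 :> 'M[R]_3.
Proof. by apply/matrixP; apply: ord3P; apply: ord3P; rewrite !mxE. Qed.

Lemma mxtrace_mx3 (a b c d f g h k l : R) :
  \tr (mx3 a b c d f g h k l) = a + f + l.
Proof. by rewrite mxtrace3E !mxE. Qed.

Lemma pm_diag3 s (a b c : R) :
  pm s (diag3 a b c) = diag3 ((-1) ^+ s * a) ((-1) ^+ s * b) ((-1) ^+ s * c).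
Proof.
by apply/matrixP; apply: ord3P; apply: ord3P; rewrite !mxE /= ?mulr0.
Qed.

Lemma adj_mx3 (a b c d f g h k l : R) :
  \adj (mx3 a b c d f g h k l) =
  mx3 (f * l - g * k) (c * k - b * l) (b * g - c * f)
      (g * h - d * l) (a * l - c * h) (c * d - a * g)
      (d * k - f * h) (b * h - a * k) (a * f - b * d).
Proof.
apply/matrixP; apply: ord3P; apply: ord3P; rewrite !mxE /cofactor
  (expand_det_row _ ord0) !big_ord_recl big_ord0 /cofactor !det_mx11 !mxE /=;
  by ring.
Qed.

Definition cross (x y : 'rV[R]_3) : 'rV[R]_3 :=
  \row_k nth 0 [:: x 0 i1 * y 0 i2 - x 0 i2 * y 0 i1;
                   x 0 i2 * y 0 i0 - x 0 i0 * y 0 i2;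
                   x 0 i0 * y 0 i1 - x 0 i1 * y 0 i0] k.

Lemma cross0l y : cross 0 y = 0.
Proof.
by apply/rowP; apply: ord3P; rewrite !mxE /= !mul0r subrr.
Qed.

Lemma cross0r x : cross x 0 = 0.
Proof.
by apply/rowP; apply: ord3P; rewrite !mxE /= !mulr0 subrr.
Qed.

(** The sign in [e1, e3] = -e5 is exactly the orientation of the second component of the cross
    product. *)
Lemma bracket_cross (x y : 'rV[R]_(3 + 3)) :
  (bracket x y : 'rV_(3 + 3)) = row_mx 0 (cross (lsubmx x) (lsubmx y)).
Proof.
have co (z : 'rV[R]_(3 + 3)) (k : 'I_3) : coord z k.+1 = lsubmx z 0 k.
  by rewrite /coord mxE; congr (z 0 _); apply: val_inj; rewrite /= inordK ?(leq_trans (ltn_ord k)).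
rewrite /bracket ![coord _ 1](co _ i0) ![coord _ 2](co _ i1) ![coord _ 3](co _ i2).
apply/rowP => k; case: (split_ordP k) => j ->; rewrite ?row_mxEl ?row_mxEr;
  move: j; apply: ord3P; rewrite !mxE -!val_eqE /= !inordK //=; ring.
Qed.

Lemma form_center S M E u v :
  form (metric S M E) (row_mx 0 u) (row_mx 0 v) = form E u v.
Proof.
by rewrite /form /metric mul_row_block tr_row_mx mul_row_col trmx0 mulmx0
  !mul0mx !add0r.
Qed.

Lemma sym_mx3 A : A^T = A ->
  [/\ A i1 i0 = A i0 i1, A i2 i0 = A i0 i2 & A i2 i1 = A i1 i2].
Proof. by move=> sA; split; rewrite -{1}sA mxE. Qed.

Lemma form3E E u v :
  form E u v = (u 0 i0 * E i0 i0 + u 0 i1 * E i1 i0 + u 0 i2 * E i2 i0) * v 0 i0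
             + (u 0 i0 * E i0 i1 + u 0 i1 * E i1 i1 + u 0 i2 * E i2 i1) * v 0 i1
             + (u 0 i0 * E i0 i2 + u 0 i1 * E i1 i2 + u 0 i2 * E i2 i2) * v 0 i2.
Proof. by rewrite /form mxE sum3E !mxE !sum3E. Qed.

Lemma crossE (x y : 'rV[R]_3) :
  (cross x y 0 i0 = x 0 i1 * y 0 i2 - x 0 i2 * y 0 i1) *
  (cross x y 0 i1 = x 0 i2 * y 0 i0 - x 0 i0 * y 0 i2) *
  (cross x y 0 i2 = x 0 i0 * y 0 i1 - x 0 i1 * y 0 i0).
Proof. by rewrite !mxE. Qed.

(** The cofactor matrix of [A] sends the cross product of two basis vectors to that of the
    corresponding rows of [A]; each basis vector arises, up to sign, from two ordered pairs, hence
    the factor 2. *)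
Lemma trace_cross A E : A^T = A ->
  \sum_i \sum_j form E (cross (delta_mx 0 i) (delta_mx 0 j))
                       (cross (row i A) (row j A))
  = 2 * \tr (\adj A *m E).
Proof.
move=> /sym_mx3[a10 a20 a21].
rewrite [X in \adj X]mx3_eta [X in _ *m X]mx3_eta adj_mx3 mul_mx3 mxtrace3E.
rewrite ![mx3 _ _ _ _ _ _ _ _ _ _ _]mxE /=.
have r i j : row i A 0 j = A i j by rewrite mxE.
have d (i j : 'I_3) : (delta_mx 0 i : 'rV[R]_3) 0 j = (j == i)%:R by rewrite mxE.
rewrite !sum3E !form3E !crossE !r !d a10 a20 a21 /=.
ring.
Qed.

End Matrices3.

(** * Scalar curvature of the metrics on the cotangent algebra of h_3 *)

Section TangentHeisenberg.
Variable R : realType.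
Implicit Types S M E : 'M[R]_3.

Lemma ulsubmx_inv_metric_sym S M E : S^T = S -> E^T = E ->
  (ulsubmx (invmx (metric S M E)))^T = ulsubmx (invmx (metric S M E)).
Proof.
by move=> sS sE; rewrite trmx_ulsub trmx_inv /metric tr_block_mx sS sE trmxK.
Qed.

(** The bracket sees only the first three coordinates, so [bracket_norm] reduces to indices below 3,
    where the dual vectors project to the rows of the upper left block of the inverse. *)
Lemma tau_adj S M E : S^T = S -> E^T = E -> metric S M E \in unitmx ->
  tau S M E = - (\tr (\adj (ulsubmx (invmx (metric S M E))) *m E) / 2).
Proof.
move=> sS sE uG; pose G := metric S M E.
have sG : G^T = G by rewrite /G /metric tr_block_mx sS sE trmxK.
have sA := ulsubmx_inv_metric_sym M sS sE.
rewrite /tau (scalar_curvature_two_step (@bracket_linear R) (@bracketC R)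
  (@bracket_nilpotent R) sG uG).
suff -> : bracket_norm (@bracket R) G = 2 * \tr (\adj (ulsubmx (invmx G)) *m E).
  by rewrite /G; field.
rewrite -trace_cross // /bracket_norm (@big_split_ord _ _ _ 3 3) /=.
have dl (i : 'I_3) : lsubmx (delta_mx 0 (lshift 3 i) : 'rV[R]_(3 + 3)) = delta_mx 0 i.
  by apply/rowP => j; rewrite !mxE.
have dr (i : 'I_3) : lsubmx (delta_mx 0 (rshift 3 i) : 'rV[R]_(3 + 3)) = 0.
  by apply/rowP => j; rewrite !mxE /= eq_lrshift.
have dd (i : 'I_3) : lsubmx (dual_basis G (lshift 3 i)) = row i (ulsubmx (invmx G)).
  by apply/rowP => j; rewrite !mxE.
rewrite [X in _ + X]big1 ?addr0; last first.
  by move=> i _; rewrite big1 // => j _; rewrite bracket_cross dr cross0l row_mx0 form0l.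
apply: eq_bigr => i _; rewrite (@big_split_ord _ _ _ 3 3) /=.
rewrite [X in _ + X]big1 ?addr0; last first.
  by move=> j _; rewrite bracket_cross dr cross0r row_mx0 form0l.
by apply: eq_bigr => j _; rewrite !bracket_cross form_center !dl !dd.
Qed.

(** The first block column of the product of the Gram matrix with its inverse. *)
Lemma metric_inv S M E (uG : metric S M E \in unitmx) :
  S *m ulsubmx (invmx (metric S M E)) + M *m dlsubmx (invmx (metric S M E)) = 1%:M
  /\ M^T *m ulsubmx (invmx (metric S M E))
     + E *m dlsubmx (invmx (metric S M E)) = 0.
Proof.
have := mulmxV uG; rewrite -[invmx (metric S M E) in LHS]submxK.
rewrite {1}/metric mulmx_block (@scalar_mx_block _ 3 3).
by move/eq_block_mx => [-> _ -> _].
Qed.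

Lemma tau_inverse S M E A B B' C : S^T = S -> E^T = E ->
  metric S M E *m block_mx A B B' C = 1%:M ->
  tau S M E = - (\tr (\adj A *m E) / 2).
Proof.
move=> sS sE GX; have [uG _] := mulmx1_unit GX.
rewrite tau_adj //; congr (- (\tr (\adj _ *m _) / _)).
have -> : invmx (metric S M E) = block_mx A B B' C.
  by rewrite -[RHS](mulKmx uG) GX mulmx1.
by rewrite block_mxKul.
Qed.

Lemma tau_nondegenerate_center S E : S^T = S -> E^T = E ->
  metric S 0 E \in unitmx -> tau S 0 E = - (\tr (S *m E) / (2 * \det S)).
Proof.
move=> sS sE uG; rewrite tau_adj //.
have [] := metric_inv uG; rewrite mul0mx addr0 => SA _.
move: (ulsubmx _) SA => A SA.
have [uS _] := mulmx1_unit SA.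
have dS : \det S != 0 by rewrite -unitfE -unitmxE.
have dA : \det A = (\det S)^-1.
  by apply: (mulfI dS); rewrite -det_mulmx SA det1 divff.
(* Insert [S *m A = 1%:M] in front of the adjugate and use [A *m \adj A = (\det A)%:M]. *)
have -> : \adj A = (\det S)^-1 *: S.
  by rewrite -[\adj A]mul1mx -SA -mulmxA mul_mx_adj dA mul_mx_scalar.
by rewrite -scalemxAl mxtraceZ; field.
Qed.

Lemma tau_form_a s22 s33 t2 t3 : s22 != 0 -> s33 != 0 -> t2 != 0 -> t3 != 0 ->
  tau (diag3 0 s22 s33) (M13 R) (diag3 0 t2 t3) = - (t3 / (2 * s22 * s33)).
Proof.
move=> s22N0 s33N0 t2N0 t3N0.
(* The first column of [M13] forces rows 1 and 3 of [A] to be opposite. Hence the principal minor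
   that multiplies [t2] vanishes, and the one that multiplies [t3] is the inverse of [s22 * s33]. *)
rewrite (tau_inverse (A := mx3 s33^-1 0 (- s33^-1) 0 s22^-1 0 (- s33^-1) 0 s33^-1)
   (B := M1 R) (B' := M1 R) (C := diag3 0 t2^-1 t3^-1)).
- by rewrite adj_mx3 mul_mx3 mxtrace_mx3; field; rewrite s22N0 s33N0.
- by rewrite trmx_mx3.
- by rewrite trmx_mx3.
rewrite /metric mulmx_block (@scalar_mx_block _ 3 3) !trmx_mx3 !mul_mx3 !add_mx3.
rewrite mx3_0 mx3_1; congr (block_mx (mx3 _ _ _ _ _ _ _ _ _) (mx3 _ _ _ _ _ _ _ _ _)
  (mx3 _ _ _ _ _ _ _ _ _) (mx3 _ _ _ _ _ _ _ _ _)); by field.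
Qed.

Lemma tau_form_c s12 t2 t3 : s12 != 0 -> t2 != 0 -> t3 != 0 ->
  tau (S12 s12) (M3 R) (diag3 0 t2 t3) = t3 / (2 * s12 ^+ 2).
Proof.
move=> s12N0 t2N0 t3N0.
(* The first column of [M3] forces the third row of [A] to vanish; the rest of [A] inverts the
   leading 2 x 2 block of [S12 s12]. *)
rewrite (tau_inverse (A := S12 s12^-1) (B := M3 R) (B' := (M3 R)^T)
   (C := diag3 0 t2^-1 t3^-1)).
- by rewrite adj_mx3 mul_mx3 mxtrace_mx3; field.
- by rewrite trmx_mx3.
- by rewrite trmx_mx3.
rewrite /metric mulmx_block (@scalar_mx_block _ 3 3) !trmx_mx3 !mul_mx3 !add_mx3.
rewrite mx3_0 mx3_1; congr (block_mx (mx3 _ _ _ _ _ _ _ _ _) (mx3 _ _ _ _ _ _ _ _ _)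
  (mx3 _ _ _ _ _ _ _ _ _) (mx3 _ _ _ _ _ _ _ _ _)); by field.
Qed.

Lemma tau_diag3 S M t1 t2 t3 (A := ulsubmx (invmx (metric S M (diag3 t1 t2 t3)))) :
  S^T = S -> metric S M (diag3 t1 t2 t3) \in unitmx ->
  tau S M (diag3 t1 t2 t3) =
  - ((t1 * (A i1 i1 * A i2 i2 - A i1 i2 ^+ 2) +
      t2 * (A i0 i0 * A i2 i2 - A i0 i2 ^+ 2) +
      t3 * (A i0 i0 * A i1 i1 - A i0 i1 ^+ 2)) / 2).
Proof.
move=> sS uG; have sE : (diag3 t1 t2 t3)^T = diag3 t1 t2 t3 by rewrite trmx_mx3.
have /sym_mx3[a10 a20 a21] : A^T = A by exact: ulsubmx_inv_metric_sym.
rewrite tau_adj // -/A [X in \adj X]mx3_eta adj_mx3 mul_mx3 mxtrace_mx3.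
by rewrite a10 a20 a21; field.
Qed.

(** In row [j] of the second identity of [metric_inv], the null row of [E] removes the unknown lower
    left block. *)
Lemma inv_metric_null_col S M E j : metric S M E \in unitmx ->
  (forall k, E j k = 0) -> forall l,
  let A := ulsubmx (invmx (metric S M E)) in
  M i0 j * A i0 l + M i1 j * A i1 l + M i2 j * A i2 l = 0.
Proof.
move=> /metric_inv[_] MA Ej l /=; move: (ulsubmx _) (dlsubmx _) MA => A L.
by move/matrixP/(_ j l); rewrite !mxE !sum3E ![M^T _ _]mxE !Ej !mul0r !addr0.
Qed.

(** Otherwise [row_mx 0 c] would be a central vector in the radical of the metric. *)
Lemma metric_unit_ker S M E (c : 'rV[R]_3) : metric S M E \in unitmx ->
  c *m E = 0 -> c *m M^T = 0 -> c = 0.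
Proof.
move=> uG cE cM; have : row_mx 0 c *m metric S M E = 0.
  by rewrite mul_row_block !mul0mx !add0r cM cE row_mx0.
move/(congr1 (mulmx^~ (invmx (metric S M E)))); rewrite mulmxK // mul0mx.
by rewrite -row_mx0 => /eq_row_mx[].
Qed.

(** The first row of [A] vanishes, and the only principal minor avoiding it has coefficient 0. This
    covers (b), (f) and (g). *)
Lemma tau_M1 S t2 t3 : S^T = S -> metric S (M1 R) (diag3 0 t2 t3) \in unitmx ->
  tau S (M1 R) (diag3 0 t2 t3) = 0.
Proof.
move=> sS uG; rewrite tau_diag3 //.
have := inv_metric_null_col (j := i0) uG; move: (ulsubmx _) => A /= h.
have {}h l : A i0 l = 0.
  rewrite -[RHS](h _ l) ?mxE /= ?mxE /=; last by apply: ord3P; rewrite mxE.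
  by rewrite mul1r !mul0r !addr0.
by rewrite !h; ring.
Qed.

(** Rows 2 and 3 of [A] are opposite, so the two principal minors in [tau_diag3] with coefficients
    [t] and [- t] agree and cancel. This covers (d) and (e). *)
Lemma tau_M23 S t : S^T = S -> metric S (M23 R) (diag3 0 t (- t)) \in unitmx ->
  tau S (M23 R) (diag3 0 t (- t)) = 0.
Proof.
move=> sS uG; rewrite tau_diag3 //.
have /sym_mx3 : (ulsubmx (invmx (metric S (M23 R) (diag3 0 t (- t)))))^T
  = ulsubmx (invmx (metric S (M23 R) (diag3 0 t (- t)))).
  by apply: ulsubmx_inv_metric_sym; rewrite ?trmx_mx3.
have := inv_metric_null_col (j := i0) uG; move: (ulsubmx _) => A /= h [a10 a20 a21].
have {}h l : A i2 l = - A i1 l.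
  apply/eqP; rewrite -addr_eq0 -[X in _ == X](h _ l) ?mxE /=.
    by rewrite mul0r !mul1r add0r addrC.
  by apply: ord3P; rewrite mxE.
have a12 : A i1 i2 = - A i1 i1 by rewrite -a21 h.
have a02 : A i0 i2 = - A i0 i1 by rewrite -a20 h a10.
by rewrite a02 h a12; ring.
Qed.

(** Only the leading 2 x 2 minor of [A] matters. Were it non-zero, the kernel of [A] would contain
    no non-zero vector with third entry 0, while it contains the first two columns of [M], which are
    independent by nondegeneracy. With [t = 0] this also handles rank 0. *)
Lemma tau_rank_le1 S M t : S^T = S -> metric S M (diag3 0 0 t) \in unitmx ->
  tau S M (diag3 0 0 t) = 0.
Proof.
move=> sS uG; rewrite tau_diag3 //.
have /sym_mx3 : (ulsubmx (invmx (metric S M (diag3 0 0 t))))^T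
  = ulsubmx (invmx (metric S M (diag3 0 0 t))).
  by apply: ulsubmx_inv_metric_sym; rewrite ?trmx_mx3.
have := inv_metric_null_col (j := i0) uG.
have := inv_metric_null_col (j := i1) uG.
move: (ulsubmx _) => A /= h1 h0 [a10 a20 a21].
have {}h1 := h1 (ord3P _ _ _); have {}h0 := h0 (ord3P _ _ _).
rewrite !mxE /= in h0 h1; have {h0} h0 := h0 erefl erefl erefl.
have {h1} h1 := h1 erefl erefl erefl.
have [-> | dN0] := eqVneq (A i0 i0 * A i1 i1 - A i0 i1 ^+ 2) 0; first by ring.
have ker2 x y : x * A i0 i0 + y * A i0 i1 = 0 -> x * A i0 i1 + y * A i1 i1 = 0 ->
    x = 0 /\ y = 0.
  move=> e0 e1; split; apply: (mulIf dN0); rewrite mul0r.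
    rewrite [LHS](_ : _ = A i1 i1 * (x * A i0 i0 + y * A i0 i1)
      - A i0 i1 * (x * A i0 i1 + y * A i1 i1)); last by ring.
    by rewrite e0 e1 !mulr0 subrr.
  rewrite [LHS](_ : _ = A i0 i0 * (x * A i0 i1 + y * A i1 i1)
    - A i0 i1 * (x * A i0 i0 + y * A i0 i1)); last by ring.
  by rewrite e0 e1 !mulr0 subrr.
(* The combination of the first two columns of [M] whose third entry cancels. *)
pose v i := M i2 i1 * M i i0 - M i2 i0 * M i i1.
have vA l : v i0 * A i0 l + v i1 * A i1 l = 0.
  rewrite [LHS](_ : _ =
      M i2 i1 * (M i0 i0 * A i0 l + M i1 i0 * A i1 l + M i2 i0 * A i2 l)
      - M i2 i0 * (M i0 i1 * A i0 l + M i1 i1 * A i1 l + M i2 i1 * A i2 l)).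
    by rewrite h0 h1 !mulr0 subrr.
  by rewrite /v; ring.
have [|v0 v1] := ker2 (v i0) (v i1) _ (vA i1); first by rewrite -a10 vA.
pose c (x y : R) : 'rV[R]_3 := \row_k nth 0 [:: x; y; 0] k.
have cE x y : c x y *m diag3 0 0 t = 0.
  by apply/rowP; apply: ord3P; rewrite !mxE sum3E !mxE /=; ring.
have cM x y i : (c x y *m M^T) 0 i = x * M i i0 + y * M i i1.
  by rewrite mxE sum3E !mxE /=; ring.
(* Since [v] vanishes, its coefficient vector is killed by both [M^T] and [E], so both columns have
   third entry 0. *)
have c1 : c (M i2 i1) (- M i2 i0) = 0.
  apply: (metric_unit_ker uG (cE _ _)).
  apply/rowP; apply: ord3P; rewrite cM [RHS]mxE mulNr; [exact: v0|exact: v1|ring].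
have /rowP c1E := c1.
have M21 : M i2 i1 = 0 by have := c1E i0; rewrite !mxE.
have M20 : M i2 i0 = 0.
  by have := c1E i1; rewrite !mxE /= => /eqP; rewrite oppr_eq0 => /eqP.
have u l : M i0 i0 * A i0 l + M i1 i0 * A i1 l = 0.
  by rewrite -[RHS](h0 l) M20; ring.
have [|M00 M10] := ker2 _ _ _ (u i1); first by rewrite -a10 u.
(* Now the first column of [M] itself is zero, which puts the first central basis vector in the
   radical. *)
have /rowP/(_ i0) : c 1 0 = 0.
  apply: (metric_unit_ker uG (cE _ _)).
  by apply/rowP; apply: ord3P; rewrite cM [RHS]mxE ?M00 ?M10 ?M20; ring.
by rewrite !mxE /= => /eqP; rewrite oner_eq0.
Qed.

End TangentHeisenberg.

Theorem proposition4p2 (R : realType) :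
  (forall S E : 'M[R]_3,
     S^T = S ->
     E = E30 R \/ E = E21 R \/ E = E12 R \/ E = E03 R ->
     metric S 0 E \in unitmx ->
     tau S 0 E = - (\tr (S *m E) / (2 * \det S)))
  /\
  (forall (Epq : 'M[R]_3) (s : bool),
     Epq = E20 R \/ Epq = E11 R ->
     let eps := Epq ord_max ord_max in
     (forall s22 s33 : R, s22 != 0 -> s33 != 0 ->
        tau (diag3 0 s22 s33) (M13 R) (pm s Epq)
          = - (-1) ^+ s * (eps / (2 * s22 * s33))
        /\ tau (diag3 0 s22 s33) (M13 R) (pm s Epq) <> 0)
     /\
     (forall s12 : R, s12 != 0 ->
        tau (S12 s12) (M3 R) (pm s Epq)
          = (-1) ^+ s * (eps / (2 * s12 ^+ 2))
        /\ tau (S12 s12) (M3 R) (pm s Epq) <> 0))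
  /\
  (forall S M E : 'M[R]_3,
     degenerate_center_list S M E ->
     ~ rank2_ac S M E ->
     tau S M E = 0).
Proof.
split; [|split].
- move=> S E sS hE; apply: tau_nondegenerate_center => //.
  have E21T : (E21 R)^T = E21 R by rewrite trmx_mx3.
  by move: hE => [->|[->|[->|->]]]; rewrite /E12 /E03 ?linearN /= /E30 ?E21T ?trmx1.
- move=> Epq s hE eps.
  have [epsN0 pmE] : eps != 0 /\ pm s Epq = diag3 0 ((-1) ^+ s) ((-1) ^+ s * eps).
    rewrite /eps; case: hE => ->; rewrite pm_diag3 mxE /= mulr0 mulr1.
      by rewrite oner_neq0.
    by rewrite oppr_eq0 oner_neq0.
  have sN0 : (-1) ^+ s != 0 :> R by rewrite signr_eq0.
  have tN0 : (-1) ^+ s * eps != 0 by rewrite mulf_neq0.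
  have two : (2 : R) != 0 by rewrite pnatr_eq0.
  rewrite pmE; split=> [s22 s33 s22N0 s33N0|s12 s12N0].
    rewrite tau_form_a //; split; first by rewrite mulNr mulrA.
    by apply/eqP; rewrite oppr_eq0 mulf_neq0 // invr_neq0 // !mulf_neq0.
  rewrite tau_form_c //; split; first by rewrite -mulrA.
  by apply/eqP; rewrite mulf_neq0 // invr_neq0 // mulf_neq0 // expf_neq0.
- have E20E s : pm s (E20 R) = diag3 0 ((-1) ^+ s) ((-1) ^+ s).
    by rewrite pm_diag3 mulr0 mulr1.
  have E10E s : pm s (E10 R) = diag3 0 0 ((-1) ^+ s).
    by rewrite pm_diag3 !mulr0 mulr1.
  have zE : 0 = diag3 0 0 0 :> 'M[R]_3 by rewrite mx3_0.
  move=> S M E [+ L]; case: L => [L|[L|L]].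
  + case: L => {}S {}M.
    * move=> s [fa|[fb|fc]] uG nac.
      - by case: nac; constructor; [left|left].
      - case: fb uG {nac} => s22 s33 _ _; rewrite E20E => uG.
        by rewrite tau_M1 // trmx_mx3.
      - by case: nac; constructor; [left|right].
    * by move=> s ac _ []; constructor; [right|].
    (* [E11] unfolds to [diag3 0 1 (-1)], so [tau_M23] applies with [t = 1]. *)
    * by move=> F uG _;
        case: F uG => [[??? ?]|[[??? ?]|[[? ?]|[[? ?]|[? ?]]]]] uG;
        rewrite ?tau_M1 ?tau_M23 // trmx_mx3.
  + case: L => {}M s t _ uG _; rewrite !E10E in uG *.
    by rewrite tau_rank_le1 // trmx_mx3.
  + by case: L => {}M _ _ uG _; rewrite [X in tau _ _ X]zE tau_rank_le1 -?zE ?trmx0.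
Qed.
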